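(* Let $\mathcal W\colon[0,\infty)^2\to\mathbb R$, $(x_1,x_2)\mapsto\mathcal W(x_1,x_2)$, be differentiable and let $W\colon\mathrm{GL}^+(3)\to\mathbb R$ be the elastic energy function $$W(F)=\mathcal W\bigl(\|\operatorname{dev}_3\log U\|^2,\ |\operatorname{tr}\log U|^2\bigr),\qquad U=\sqrt{F^TF}.$$ Assume that $$\frac{\partial\mathcal W}{\partial x_1}\bigl(\|\operatorname{dev}_3\log U\|^2,\ |\operatorname{tr}\log U|^2\bigr)>0\qquad\text{for all } U\in\mathrm{Sym}^+(3).$$ Then the Cauchy stress response induced by $W$ satisfies the weak empirical inequalities (WE-TSS).
   Context: $\mathrm{GL}^+(3)$ is the group of real $3\times3$ matrices with positive determinant, $\mathrm{Sym}(3)$ the real symmetric $3\times 3$ matrices, $\mathrm{Sym}^+(3)$ the positive definite ones, $\mathbb 1$ the identity matrix, $\log$ the principal matrix logarithm on $\mathrm{Sym}^+(3)$, $\|X\|^2=\operatorname{tr}(X^TX)$ the Frobenius norm, and $\operatorname{dev}_3X=X-\frac13\operatorname{tr}(X)\,\mathbb 1$. The Cauchy stress induced by a differentiable energy $W$ on $\mathrm{GL}^+(3)$ is $\sigma(F)=\frac1{\det F}\,DW(F)\,F^T$. For an isotropic energy such as the one considered, $\sigma(F)$ depends only on $B=FF^T$, and the induced Cauchy stress response is the isotropic function $\widehat\sigma\colon\mathrm{Sym}^+(3)\to\mathrm{Sym}(3)$ with $\widehat\sigma(FF^T)=\sigma(F)$; here isotropic means $\widehat\sigma(Q^TBQ)=Q^T\widehat\sigma(B)Q$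 for all orthogonal $Q$. An isotropic function $\widehat\sigma\colon\mathrm{Sym}^+(3)\to\mathrm{Sym}(3)$ satisfies the weak empirical inequalities (WE-TSS) if it can be written as $\widehat\sigma(B)=\beta_0\,\mathbb 1+\beta_1\,B+\beta_{-1}\,B^{-1}$, with $\beta_0,\beta_1,\beta_{-1}$ scalar-valued functions of the principal invariants of $B$, such that for every $B\in\mathrm{Sym}^+(3)$ which is not a positive multiple of $\mathbb 1$, $\beta_{-1}\le0$ and $\beta_1\ge0$ with at least one of the two inequalities being strict (which one may depend on $B$). *)

(* Defs.v *)
From HB Require Import structures.
From mathcomp Require Import all_boot all_order all_algebra.
From mathcomp Require Import all_classical all_reals all_analysis.

Set Implicit Arguments.
Unset Strict Implicit.
Unset Printing Implicit Defensive.

Import Order.TTheory GRing.Theory Num.Theory.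
Import numFieldNormedType.Exports.

Local Open Scope classical_set_scope.
Local Open Scope ring_scope.

Section Defs.
Context {R : realType}.
Implicit Types (A B F U X : 'M[R]_3) (W : 'M[R]_3 -> R) (w : R * R -> R).

Definition GLpos : set 'M[R]_3 := [set F | 0 < \det F].

Definition sympos : set 'M[R]_3 :=
  [set A | A \is symmetricmx /\
           forall v : 'rV[R]_3, v != 0 -> 0 < (v *m A *m v^T) 0 0].

Definition expm X : 'M[R]_3 :=
  limn (series (fun n => (n`!%:R^-1 : R) *: X ^+ n)).

(* The principal logarithm of a positive definite symmetric matrix is its only
   real symmetric logarithm: the spectrum of a real symmetric matrix is real,
   hence lies in the strip |Im z| < pi. Only meaningful on [sympos]. *)
Definition logm A : 'M[R]_3 := get [set X | X \is symmetricmx /\ expm X = A].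

(* Only meaningful on [sympos], where there is exactly one such U. *)
Definition sqrtm A : 'M[R]_3 := get [set U | sympos U /\ U *m U = A].

Definition frobnorm2 X : R := \tr (X^T *m X).

Definition dev3 X : 'M[R]_3 := X - (3%:R^-1 * \tr X)%:M.

Definition log_strains U : R * R :=
  (frobnorm2 (dev3 (logm U)), `|\tr (logm U)| ^+ 2).

Definition quadrant : set (R * R) := [set x | 0 <= x.1 /\ 0 <= x.2].

(* Differentiability relative to the closed quadrant: only the values of [w]
   on the quadrant matter, and the expansion is one-sided at its boundary. *)
Definition quadrant_differentiable w :=
  forall x : R * R, quadrant x -> differentiable w (within quadrant (nbhs x)).

(* Partial derivative in the first variable, one-sided where x.1 = 0. *)
Definition partial1 w (x : R * R) : R :=
  lim (h^-1 * (w (x.1 + h, x.2) - w x)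
        @[h --> within [set h : R | quadrant (x.1 + h, x.2)] 0^']).

(* Only meaningful on [GLpos]. *)
Definition energy w F : R := w (log_strains (sqrtm (F^T *m F))).

(* The matrix representing the differential of [W] at [F] with respect to the
   inner product <X, Y> = tr (X^T Y). *)
Definition mxgrad W F : 'M[R]_3 := \matrix_(i, j) 'd W F (delta_mx i j).

Definition cauchy_stress W F : 'M[R]_3 :=
  (\det F)^-1 *: (mxgrad W F *m F^T).

(* [s] restricts to an isotropic function from [sympos] to the symmetric
   matrices; its values outside [sympos] are irrelevant. *)
Definition isotropic (s : 'M[R]_3 -> 'M[R]_3) : Prop :=
  (forall B, sympos B -> s B \is symmetricmx) /\
  (forall B Q : 'M[R]_3, sympos B -> Q^T *m Q = 1%:M ->
     s (Q^T *m B *m Q) = Q^T *m s B *m Q).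

(* Every B in [sympos] is F F^T for some F in [GLpos] (take F = sqrtm B), so the
   last clause determines [s] on [sympos]. *)
Definition cauchy_response W (s : 'M[R]_3 -> 'M[R]_3) : Prop :=
  [/\ forall F, GLpos F -> differentiable W F,
      isotropic s
    & forall F, GLpos F -> s (F *m F^T) = cauchy_stress W F].

Definition inv1 B : R := \tr B.
Definition inv2 B : R := ((\tr B) ^+ 2 - \tr (B *m B)) / 2%:R.
Definition inv3 B : R := \det B.

Definition WE_TSS (s : 'M[R]_3 -> 'M[R]_3) : Prop :=
  exists b0 b1 bm1 : R -> R -> R -> R,
    (forall B, sympos B ->
       s B = (b0 (inv1 B) (inv2 B) (inv3 B))%:M
             + b1 (inv1 B) (inv2 B) (inv3 B) *: B
             + bm1 (inv1 B) (inv2 B) (inv3 B) *: invmx B) /\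
    (forall B, sympos B -> ~ (exists a : R, 0 < a /\ B = a%:M) ->
       [/\ bm1 (inv1 B) (inv2 B) (inv3 B) <= 0,
           0 <= b1 (inv1 B) (inv2 B) (inv3 B)
         & bm1 (inv1 B) (inv2 B) (inv3 B) < 0 \/
           0 < b1 (inv1 B) (inv2 B) (inv3 B)]).

End Defs.

(* Main.v *)
Require Import Defs.
From HB Require Import structures.
From mathcomp Require Import all_boot all_order all_algebra.
From mathcomp Require Import all_classical all_reals all_analysis.
From mathcomp Require Import complex spectral ring lra.
Import Order.TTheory GRing.Theory Num.Theory.
Import numFieldNormedType.Exports.
Local Open Scope classical_set_scope.
Local Open Scope ring_scope.

(** Write [C = F^T F], [B = F F^T] and [l(c) = ln c / 2], so that [log U = l(C)].
    The two arguments of the energy are [tr l^2(C) - (tr l(C))^2 / 3] and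
    [(tr l(C))^2]. Hence everything rests on differentiating trace functions
    [tr f(C)].

    Their derivative is [H |-> tr (H f'(C))]. The proof ([trace_taylor_remainder])
    avoids perturbing eigenvalues or eigenvectors: with eigenpairs [(a_i, u_i)]
    of [A] and [(b_j, v_j)] of [C], the remainder
    [tr f(A) - tr f(C) - tr ((A - C) f'(C))] is the sum over [i, j] of
    [<u_i, v_j>^2 (f(a_i) - f(b_j) - (a_i - b_j) f'(b_j))], while
    [|A - C|^2] is the sum of [<u_i, v_j>^2 (a_i - b_j)^2]. A quadratic bound
    for the scalar Taylor remainder therefore gives the same bound for matrices.

    By the chain rule the gradient of [F |-> tr f(F^T F)] is [2 F f'(C)], and
    [2 F f'(C) F^T = 2 f'(B) B] because [F C = B F]. For [f = l] this is the
    identity and for [f = l^2] it is [log B]. With [w1], [w2] the partial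
    derivatives of the energy function, the Cauchy stress is thus
    [(w1 log B + k 1) / det F] with a scalar [k] ([cauchy_stress_energy]), where
    [w1], [w2], [k] and [det F] depend on the eigenvalues of [B] only.

    It remains to write [log B] as [a0 1 + a1 B + c B^-1] with [a1 >= 0 >= c],
    one of them strict, whenever [B] has two distinct eigenvalues. This is
    interpolation of [ln] at the eigenvalues by [a0 + a1 t + c / t]; the signs
    come from the convexity of [t ln t] and the concavity of [- s ln s]
    ([ln_interpolation]). As [w1 > 0] and [det F > 0], the signs carry over to
    the stress. The invariants determine the eigenvalues, so the coefficients
    can be chosen as functions of the invariants. *)

Set Implicit Arguments.
Unset Strict Implicit.
Unset Printing Implicit Defensive.

(** * Diagonalisation of real symmetric matrices *)

(** A complex eigenvalue exists, it is real because a real symmetric matrix is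
    Hermitian, and being an eigenvalue does not depend on the field. *)
Lemma sym_real_eigenvalue (R : rcfType) (n : nat) (A : 'M[R]_n.+1) :
  A^T = A -> exists a : R, eigenvalue A a.
Proof.
move=> symA; pose toC : {rmorphism R -> R[i]} := real_complex R.
pose AC : 'M[R[i]]_n.+1 := map_mx toC A.
have hermA : AC \is hermsymmx.
  apply: realsym_hermsym.
    by apply/is_hermitianmxP; rewrite scale1r map_mx_id // /AC map_trmx symA.
  apply/mxOverP => i j; rewrite mxE complex_real.
  by apply/eqP.
have /mxOverP/(_ 0 0) := hermitian_spectral_diag_real hermA.
have := hermitian_normalmx hermA => /orthomx_spectralP.
set P := spectralmx _; set d := spectral_diag _ => defA.
move=> d_real; exists (complex.Re (d 0 0)).
rewrite -(eigenvalue_map toC) -/AC.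
have -> : toC (complex.Re (d 0 0)) = d 0 0.
  by move: d_real; case: (d 0 0) => x y; rewrite complex_real => /eqP /= ->.
apply/eigenvalueP; exists (row 0 P).
  rewrite [X in _ *m X = _]defA -row_mul !mulmxA mulmxV ?spectral_unit //.
  rewrite mul1mx row_mul; apply/rowP => j; rewrite !mxE.
  rewrite (bigD1 0) //= big1 ?addr0; last first.
    by move=> i i0; rewrite !mxE eq_sym (negbTE i0) mulr0n mul0r.
  by rewrite !mxE eqxx mulr1n.
have : row_free P by rewrite row_free_unit spectral_unit.
move=> /row_freeP[Q PQ]; apply/eqP => P0.
have := congr1 (row 0) PQ; rewrite row_mul P0 mul0mx => /rowP/(_ 0).
by rewrite !mxE eqxx => /eqP; rewrite eq_sym oner_eq0.
Qed.

Lemma mul_row_tr_ge0 (R : realDomainType) (n : nat) (u : 'rV[R]_n) :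
  0 <= (u *m u^T) 0 0.
Proof.
by rewrite mxE sumr_ge0 // => i _; rewrite !mxE -expr2 sqr_ge0.
Qed.

Lemma mul_row_tr_eq0 (R : realDomainType) (n : nat) (u : 'rV[R]_n) :
  ((u *m u^T) 0 0 == 0) = (u == 0).
Proof.
apply/idP/eqP => [|->]; last by rewrite mul0mx mxE.
rewrite mxE psumr_eq0 => [/allP u0|i _]; last by rewrite !mxE -expr2 sqr_ge0.
apply/rowP => j; have := u0 j (mem_index_enum j).
by rewrite /= !mxE -expr2 sqrf_eq0 => /eqP.
Qed.

(** [H] is the reflection in the hyperplane orthogonal to [e - v]. *)
Lemma householder (R : realFieldType) (n : nat) (e v : 'rV[R]_n) :
  e *m e^T = 1%:M -> v *m v^T = 1%:M ->
  exists H : 'M[R]_n, [/\ H^T = H, H *m H = 1%:M & e *m H = v].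
Proof.
move=> ee vv; have [u defu] : exists u, u = e - v by exists (e - v).
have [u0|u_neq0] := eqVneq u 0.
  exists 1%:M; rewrite trmx1 !mulmx1; split => //.
  by apply: subr0_eq; rewrite -defu.
have [c uu] : exists c, u *m u^T = c%:M.
  by exists ((u *m u^T) 0 0); rewrite [LHS]mx11_scalar.
have c_neq0 : c != 0.
  by have := mul_row_tr_eq0 u; rewrite uu mxE eqxx mulr1n (negbTE u_neq0) => ->.
have eu : e *m u^T = (c / 2%:R)%:M.
  have ve : v *m e^T = e *m v^T.
    by rewrite [RHS]mx11_scalar -tr_scalar_mx -mx11_scalar trmx_mul trmxK.
  have cE : c%:M = 2%:R *: (e *m u^T).
    rewrite -uu defu !linearB /= !mulmxBl ve ee vv.
    by apply/matrixP => i j; rewrite !mxE; ring.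
  by rewrite mulrC -scale_scalar_mx cE scalerA mulVf ?scale1r // pnatr_eq0.
exists (1%:M - (2%:R / c) *: (u^T *m u)); split.
- by rewrite linearB linearZ /= trmx1 trmx_mul trmxK.
- have XX : (u^T *m u) *m (u^T *m u) = c *: (u^T *m u).
    by rewrite mulmxA -(mulmxA u^T) uu mul_mx_scalar -scalemxAl.
  rewrite mulmxBl mul1mx mulmxBr mulmx1 -scalemxAl -scalemxAr XX !scalerA.
  rewrite -addrA -opprD -scalerBl -scalerDl.
  have -> : 2 / c + (2 / c - 2 / c * (2 / c) * c) = 0 :> R by field.
  by rewrite scale0r subr0.
- rewrite mulmxBr mulmx1 -scalemxAr mulmxA eu mul_scalar_mx scalerA.
  have -> : 2 / c * (c / 2) = 1 :> R by field.
  by rewrite scale1r defu opprB addrC subrK.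
Qed.

(** Split off the line of an eigenvector with a Householder reflection, and
    continue in its orthogonal complement. *)
Theorem sym_spectral (R : rcfType) (n : nat) (A : 'M[R]_n) : A^T = A ->
  exists P : 'M[R]_n, exists d : 'rV[R]_n,
    P *m P^T = 1%:M /\ A = P^T *m diag_mx d *m P.
Proof.
elim: n A => [|n IHn] A symA.
  by exists 1%:M, 0; split; apply/matrixP => -[].
have [a /eigenvalueP[v vA v_neq0]] := sym_real_eigenvalue symA.
pose c := Num.sqrt ((v *m v^T) 0 0).
have c_gt0 : 0 < c.
  by rewrite sqrtr_gt0 lt_def mul_row_tr_eq0 v_neq0 mul_row_tr_ge0.
pose v1 := c^-1 *: v.
have v1A : v1 *m A = a *: v1 by rewrite -scalemxAl vA !scalerA mulrC.
have v1v1 : v1 *m v1^T = 1%:M.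
  rewrite linearZ /= -scalemxAl -scalemxAr [v *m _]mx11_scalar.
  rewrite -[_ 0 0]sqr_sqrtr ?mul_row_tr_ge0 // -/c.
  rewrite scalerA scale_scalar_mx expr2 mulrACA mulVf ?mulr1 //.
  exact: lt0r_neq0.
pose e : 'rV[R]_(1 + n) := row_mx 1%:M 0.
have ee : e *m e^T = 1%:M.
  by rewrite tr_row_mx mul_row_col trmx1 mulmx1 trmx0 mulmx0 addr0.
have [H [symH HH eH]] := householder ee v1v1.
pose B : 'M[R]_(1 + n) := H *m A *m H.
have symB : B^T = B by rewrite /B !trmx_mul symA symH mulmxA.
have eB : e *m B = a *: e.
  by rewrite /B !mulmxA eH v1A -scalemxAl -eH -mulmxA HH mulmx1.
have defB : B = block_mx a%:M 0 0 (drsubmx B).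
  have := eB; rewrite -[B in LHS]submxK /e mul_row_block !mul1mx !mul0mx !addr0.
  rewrite scale_row_mx scaler0 => /eq_row_mx[Bul Bur].
  have Bdl : dlsubmx B = 0 by rewrite -[LHS]trmxK trmx_dlsub symB Bur trmx0.
  by rewrite -[LHS]submxK Bul Bur Bdl scalemx1.
have symBdr : (drsubmx B)^T = drsubmx B by rewrite trmx_drsub symB.
have [P [d [PP defBdr]]] := IHn _ symBdr.
pose Q : 'M[R]_(1 + n) := block_mx 1%:M 0 0 P.
have trQ : Q^T = block_mx 1%:M 0 0 P^T :> 'M[R]_(1 + n).
  by rewrite tr_block_mx !trmx0 trmx1.
have QQ : Q *m Q^T = 1%:M.
  rewrite trQ mulmx_block !mul0mx !mulmx0 !mulmx1.
  by rewrite !addr0 add0r PP -scalar_mx_block.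
have QBQ : B = Q^T *m diag_mx (row_mx a%:M d : 'rV[R]_(1 + n)) *m Q.
  rewrite defB defBdr diag_mx_row trQ.
  rewrite !mulmx_block !mul0mx !mulmx0 !mulmx1 !mul1mx !addr0 !add0r.
  rewrite !mul0mx; congr (block_mx _ 0 0 _).
  by apply/matrixP => i j; rewrite !mxE !ord1 eqxx.
exists (Q *m H), (row_mx a%:M d : 'rV[R]_(1 + n)); split.
  by rewrite trmx_mul symH mulmxA -(mulmxA _ H H) HH mulmx1.
have -> : A = H *m B *m H.
  by rewrite /B !mulmxA HH mul1mx -mulmxA HH mulmx1.
by rewrite trmx_mul symH QBQ !mulmxA.
Qed.

(** * Functional calculus of symmetric matrices *)

Section FunctionalCalculus.
Context {R : realType} {n : nat}.
Implicit Types (A B P Q X : 'M[R]_n) (d e : 'rV[R]_n) (f g : R -> R).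

Definition diagonalizes P d A : Prop :=
  P *m P^T = 1%:M /\ A = P^T *m diag_mx d *m P.

(** Any diagonalisation of [A] may be used, since they all give the same matrix
    ([mxfunE]); outside symmetric matrices the value is arbitrary. *)
Definition mxfun f A : 'M[R]_n :=
  get [set X | exists P d,
    diagonalizes P d A /\ X = P^T *m diag_mx (map_mx f d) *m P].

Lemma diag_mx_intertwine (f : R -> R) (d e : 'rV[R]_n) (S : 'M[R]_n) :
  diag_mx d *m S = S *m diag_mx e ->
  diag_mx (map_mx f d) *m S = S *m diag_mx (map_mx f e).
Proof.
rewrite !mul_diag_mx !mul_mx_diag => dSe; apply/matrixP => i j.
have /matrixP/(_ i j) := dSe; rewrite !mxE.
have [->|S_neq0] := eqVneq (S i j) 0; first by rewrite !mulr0 !mul0r.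
by rewrite [RHS]mulrC => /(mulIf S_neq0) ->; rewrite mulrC.
Qed.

Lemma diagonalizesVl P d A : diagonalizes P d A -> P^T *m P = 1%:M.
Proof. by move=> [/mulmx1C]. Qed.

Lemma diagonalizes_mulPA P d A : diagonalizes P d A ->
  P *m A = diag_mx d *m P.
Proof. by move=> [PP ->]; rewrite !mulmxA PP mul1mx. Qed.

Lemma diagonalizes_mulAP P d A : diagonalizes P d A ->
  A *m P^T = P^T *m diag_mx d.
Proof. by move=> [PP ->]; rewrite -!mulmxA PP mulmx1. Qed.

(** If [A X = X B] then [X], read in eigenbases of [A] and [B], only couples
    equal eigenvalues; hence it intertwines [f A] and [f B] as well. *)
Lemma diagonalizes_intertwine P d A Q e B X f :
  diagonalizes P d A -> diagonalizes Q e B -> A *m X = X *m B ->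
  P^T *m diag_mx (map_mx f d) *m P *m X =
  X *m (Q^T *m diag_mx (map_mx f e) *m Q).
Proof.
move=> PdA QeB AX; have PA := diagonalizes_mulPA PdA.
have BQ := diagonalizes_mulAP QeB.
have PP := diagonalizesVl PdA; have QQ := diagonalizesVl QeB.
have /diag_mx_intertwine-/(_ f) dS : diag_mx d *m (P *m X *m Q^T) =
    P *m X *m Q^T *m diag_mx e.
  by rewrite !mulmxA -PA -(mulmxA P A) AX -!mulmxA BQ.
transitivity (P^T *m (diag_mx (map_mx f d) *m (P *m X *m Q^T)) *m Q).
  by rewrite -!mulmxA QQ mulmx1.
by rewrite dS !mulmxA PP mul1mx.
Qed.

Lemma sym_diagonalizes A : A^T = A -> exists P d, diagonalizes P d A.
Proof. exact: sym_spectral. Qed.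

Lemma diagonalizes_sym P d A : diagonalizes P d A -> A^T = A.
Proof. by move=> [_ ->]; rewrite !trmx_mul tr_diag_mx trmxK mulmxA. Qed.

(** Intertwining by the identity matrix says that two diagonalisations of [A]
    define the same [f A]. *)
Lemma mxfunE f P d A : diagonalizes P d A ->
  mxfun f A = P^T *m diag_mx (map_mx f d) *m P.
Proof.
move=> PdA; apply: xget_unique; first by exists P, d.
move=> _ [Q [e [QeA ->]]].
have := @diagonalizes_intertwine _ _ _ _ _ _ 1%:M f QeA PdA.
by rewrite !mul1mx !mulmx1; apply.
Qed.

Lemma diagonalizes_mxfun f P d A : diagonalizes P d A ->
  diagonalizes P (map_mx f d) (mxfun f A).
Proof. by move=> PdA; split; [case: PdA|apply: mxfunE]. Qed.

Lemma mxfun_intertwine f A B X : A^T = A -> B^T = B ->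
  A *m X = X *m B -> mxfun f A *m X = X *m mxfun f B.
Proof.
move=> /sym_diagonalizes[P [d PdA]] /sym_diagonalizes[Q [e QeB]].
by rewrite (mxfunE f PdA) (mxfunE f QeB); apply: diagonalizes_intertwine.
Qed.

Lemma mxfun_sym f A : A^T = A -> (mxfun f A)^T = mxfun f A.
Proof.
by move=> /sym_diagonalizes[P [d /(diagonalizes_mxfun f)/diagonalizes_sym]].
Qed.

Lemma mxfun_conj f A Q : A^T = A -> Q^T *m Q = 1%:M ->
  mxfun f (Q^T *m A *m Q) = Q^T *m mxfun f A *m Q.
Proof.
move=> symA QQ; have QQ' := mulmx1C QQ.
have symQ : (Q^T *m A *m Q)^T = Q^T *m A *m Q.
  by rewrite !trmx_mul trmxK symA mulmxA.
have := @mxfun_intertwine f _ _ Q symA symQ.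
rewrite !mulmxA QQ' mul1mx => /(_ erefl) AQ.
by rewrite -[RHS]mulmxA AQ mulmxA QQ mul1mx.
Qed.

Lemma mxfun_comp f g A : A^T = A -> mxfun f (mxfun g A) = mxfun (f \o g) A.
Proof.
move=> /sym_diagonalizes[P [d PdA]].
rewrite (mxfunE f (diagonalizes_mxfun g PdA)) (mxfunE _ PdA).
by rewrite map_mx_comp.
Qed.

Lemma mxfunM f g A : A^T = A ->
  mxfun f A *m mxfun g A = mxfun (fun x => f x * g x) A.
Proof.
move=> /sym_diagonalizes[P [d PdA]]; rewrite !(mxfunE _ PdA).
have [PP _] := PdA; rewrite !mulmxA -(mulmxA _ P) PP mulmx1.
rewrite -(mulmxA P^T) mulmx_diag; congr (_ *m diag_mx _ *m _).
by apply/rowP => i; rewrite !mxE.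
Qed.

Lemma mxfunD f g A : A^T = A ->
  mxfun f A + mxfun g A = mxfun (fun x => f x + g x) A.
Proof.
move=> /sym_diagonalizes[P [d PdA]]; rewrite !(mxfunE _ PdA).
rewrite -mulmxDl -mulmxDr -raddfD; congr (_ *m diag_mx _ *m _).
by apply/rowP => i; rewrite !mxE.
Qed.

Lemma mxfunZ a f A : A^T = A ->
  a *: mxfun f A = mxfun (fun x => a * f x) A.
Proof.
move=> /sym_diagonalizes[P [d PdA]]; rewrite !(mxfunE _ PdA).
rewrite scalemxAl scalemxAr -linearZ; congr (_ *m diag_mx _ *m _).
by apply/rowP => i; rewrite !mxE.
Qed.

Lemma mxfun_cst a A : A^T = A -> mxfun (fun=> a) A = a%:M.
Proof.
move=> /sym_diagonalizes[P [d PdA]]; rewrite !(mxfunE _ PdA).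
have -> : map_mx (fun=> a) d = const_mx a by apply/rowP => i; rewrite !mxE.
rewrite diag_const_mx mul_mx_scalar -scalemxAl (diagonalizesVl PdA).
exact: scalemx1.
Qed.

Lemma mxfun_id A : A^T = A -> mxfun id A = A.
Proof.
move=> /sym_diagonalizes[P [d PdA]]; rewrite !(mxfunE _ PdA).
by rewrite map_mx_id //; case: PdA.
Qed.

Lemma trace_diagonalizes P d A : diagonalizes P d A ->
  \tr A = \sum_i d 0 i.
Proof. by move=> [PP ->]; rewrite mxtrace_mulC mulmxA PP mul1mx mxtrace_diag. Qed.

Lemma det_diagonalizes P d A : diagonalizes P d A ->
  \det A = \prod_i d 0 i.
Proof.
move=> [PP ->]; rewrite !det_mulmx mulrAC -det_mulmx mulmx1C // det1 mul1r.
exact: det_diag.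
Qed.

Lemma trace_mxfun f P d A : diagonalizes P d A ->
  \tr (mxfun f A) = \sum_i f (d 0 i).
Proof.
move=> /(diagonalizes_mxfun f)/trace_diagonalizes ->.
by apply: eq_bigr => i _; rewrite mxE.
Qed.

Lemma eq_mxfun f g P d A : diagonalizes P d A ->
  (forall i, f (d 0 i) = g (d 0 i)) -> mxfun f A = mxfun g A.
Proof.
move=> PdA fg; rewrite !(mxfunE _ PdA); congr (_ *m diag_mx _ *m _).
by apply/rowP => i; rewrite !mxE.
Qed.

(** Spectral decomposition: the matrices [P^T delta_ii P] are the projections
    on the eigenlines. *)
Lemma mxfun_sum f P d A : diagonalizes P d A ->
  mxfun f A = \sum_i f (d 0 i) *: (P^T *m delta_mx i i *m P).
Proof.
move=> PdA; rewrite (mxfunE _ PdA).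
have -> : diag_mx (map_mx f d) = \sum_i f (d 0 i) *: delta_mx i i.
  apply/matrixP => i j; rewrite !mxE summxE (bigD1 i) //= big1 ?addr0.
    by rewrite !mxE eqxx /= eq_sym; case: eqP => _; rewrite ?mulr1 ?mulr0.
  by move=> k ki; rewrite !mxE eq_sym (negbTE ki) mulr0.
rewrite mulmx_sumr mulmx_suml; apply: eq_bigr => i _.
by rewrite -scalemxAr -scalemxAl.
Qed.

End FunctionalCalculus.

(** * Exponential, principal logarithm and square root *)

Section ExpLogSqrt.
Context {R : realType}.
Implicit Types (A B P Q X : 'M[R]_3) (d e : 'rV[R]_3) (f g : R -> R).

Lemma symmetricmxP (n : nat) (A : 'M[R]_n) : A \is symmetricmx <-> A^T = A.
Proof.
split=> [/is_hermitianmxP|] h; last first.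
  by apply/is_hermitianmxP; rewrite scale1r map_mx_id // h.
by rewrite [in RHS]h scale1r map_mx_id.
Qed.

Lemma sympos_sym A : sympos A -> A^T = A.
Proof. by move=> [/symmetricmxP]. Qed.

Lemma sympos_eig_gt0 P d A : sympos A -> diagonalizes P d A ->
  forall i, 0 < d 0 i.
Proof.
move=> [_ posA] PdA i; have [PP _] := PdA.
have -> : d 0 i = (row i P *m A *m (row i P)^T) 0 0.
  transitivity ((P *m A *m P^T) i i).
    by rewrite (diagonalizes_mulPA PdA) -mulmxA PP mulmx1 mxE eqxx mulr1n.
  by rewrite -row_mul tr_row !mxE; apply: eq_bigr => j _; rewrite !mxE.
apply: posA; apply/eqP => Pi0.
have /(congr1 (row i)) := PP; rewrite row_mul Pi0 mul0mx => /rowP/(_ i).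
by rewrite !mxE eqxx => /eqP; rewrite eq_sym oner_eq0.
Qed.

Lemma eig_gt0_sympos P d A : diagonalizes P d A -> (forall i, 0 < d 0 i) ->
  sympos A.
Proof.
move=> PdA d_gt0; split; first exact/symmetricmxP/(diagonalizes_sym PdA).
move=> v v_neq0; have [PP ->] := PdA; set u := v *m P^T.
have u_neq0 : u != 0.
  apply: contra_neq v_neq0 => u0.
  by rewrite -[v]mulmx1 -(diagonalizesVl PdA) mulmxA -/u u0 mul0mx.
have -> : v *m (P^T *m diag_mx d *m P) *m v^T = u *m diag_mx d *m u^T.
  by rewrite /u trmx_mul trmxK !mulmxA.
have -> : (u *m diag_mx d *m u^T) 0 0 = \sum_i d 0 i * u 0 i ^+ 2.
  rewrite mxE; apply: eq_bigr => i _.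
  by rewrite mul_mx_diag !mxE expr2 mulrA (mulrC (d 0 i)).
have term_ge0 i : true -> 0 <= d 0 i * u 0 i ^+ 2.
  by move=> _; rewrite mulr_ge0 ?sqr_ge0 ?ltW.
rewrite lt_def psumr_eq0 ?sumr_ge0 // andbT.
apply/negP => /allP u0; case/eqP: u_neq0; apply/rowP => i.
have := u0 i (mem_index_enum i).
by rewrite /= mulf_eq0 (gt_eqF (d_gt0 i)) sqrf_eq0 => /eqP ->; rewrite mxE.
Qed.

Lemma sympos_mxfun f A : (forall x, 0 < x -> 0 < f x) -> sympos A ->
  sympos (mxfun f A).
Proof.
move=> f_gt0 posA; have [P [d PdA]] := sym_diagonalizes (sympos_sym posA).
apply: (eig_gt0_sympos (diagonalizes_mxfun f PdA)) => i.
by rewrite mxE; apply/f_gt0/(sympos_eig_gt0 posA PdA).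
Qed.

Lemma eq_mxfun_sympos f g A : sympos A -> (forall x, 0 < x -> f x = g x) ->
  mxfun f A = mxfun g A.
Proof.
move=> posA fg; have [P [d PdA]] := sym_diagonalizes (sympos_sym posA).
by apply: (eq_mxfun PdA) => i; apply/fg/(sympos_eig_gt0 posA PdA).
Qed.

Lemma mxfunX A k : A^T = A -> A ^+ k = mxfun (fun x => x ^+ k) A.
Proof.
move=> symA; elim: k => [|k IHk]; first by rewrite expr0 mxfun_cst.
rewrite exprS IHk -[X in X * _](mxfun_id symA) -[_ * _]/(_ *m _) mxfunM //.
by congr (mxfun _ A); apply/funext => x; rewrite exprS.
Qed.

(** By the spectral decomposition the partial sums are combinations of fixed
    projections, with the partial sums of scalar exponential series as
    coefficients. *)
Lemma expm_mxfun X : X^T = X -> expm X = mxfun expR X.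
Proof.
move=> symX; have [P [d PdX]] := sym_diagonalizes symX.
rewrite /expm; apply: cvg_lim => //.
have -> : series (fun k => (k`!%:R^-1 : R) *: X ^+ k) =
    (fun m => \sum_i series (exp_coeff (d 0 i)) m *:
                    (P^T *m delta_mx i i *m P)).
  apply/funext => m; rewrite /series /=.
  under eq_bigr do rewrite mxfunX // (mxfun_sum _ PdX) scaler_sumr.
  rewrite exchange_big /=; apply: eq_bigr => i _.
  rewrite scaler_suml; apply: eq_bigr => k _.
  by rewrite scalerA /exp_coeff /= mulrC.
rewrite (mxfun_sum _ PdX).
apply: cvg_big => [|i _]; first exact: add_continuous.
apply: cvgZr_tmp.
exact: is_cvg_series_exp_coeff.
Qed.

(** Uniqueness: a symmetric [X] is recovered from its exponential, as
    [ln (expm X) = (ln o expR) X = X]. The square root is treated likewise. *)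
Lemma logm_mxfun A : sympos A -> logm A = mxfun (@ln R) A.
Proof.
move=> posA; have symA := sympos_sym posA; apply: xget_unique.
  split; first exact/symmetricmxP/mxfun_sym.
  rewrite expm_mxfun ?mxfun_sym // mxfun_comp // -[RHS]mxfun_id //.
  by apply: eq_mxfun_sympos => // x x_gt0; rewrite /= lnK.
move=> X [/symmetricmxP symX <-]; rewrite expm_mxfun // mxfun_comp //.
rewrite -[LHS]mxfun_id //; congr (mxfun _ X).
by apply/funext => x; rewrite /= expRK.
Qed.

Lemma sqrtm_mxfun A : sympos A -> sqrtm A = mxfun Num.sqrt A.
Proof.
move=> posA; have symA := sympos_sym posA; apply: xget_unique.
  split; first by apply: sympos_mxfun posA => x; rewrite sqrtr_gt0.
  rewrite mxfunM // -[RHS]mxfun_id //; apply: eq_mxfun_sympos => // x x_gt0.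
  by rewrite -expr2 sqr_sqrtr // ltW.
move=> U [posU <-]; have symU := sympos_sym posU.
rewrite -[in RHS](mxfun_id symU) mxfunM // mxfun_comp // -[LHS]mxfun_id //.
apply: eq_mxfun_sympos => // x x_gt0.
by rewrite /= -expr2 sqrtr_sqr gtr0_norm.
Qed.

End ExpLogSqrt.

(** * First-order expansion of trace functions *)

Section TraceFunctions.
Context {R : realType} {n : nat}.
Implicit Types (A B P Q : 'M[R]_n) (d e : 'rV[R]_n) (f g : R -> R).

(** The weights [(P Q^T)_ij ^ 2] are the squared cosines between the
    eigenvectors of [A] and those of [B]. *)
Lemma trace_mxfun_mul P d A Q e B f g :
  diagonalizes P d A -> diagonalizes Q e B ->
  \tr (mxfun f A *m mxfun g B) =
  \sum_i \sum_j (P *m Q^T) i j ^+ 2 * (f (d 0 i) * g (e 0 j)).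
Proof.
move=> PdA QeB; rewrite (mxfunE f PdA) (mxfunE g QeB).
have -> : \tr (P^T *m diag_mx (map_mx f d) *m P *m
               (Q^T *m diag_mx (map_mx g e) *m Q)) =
  \tr (diag_mx (map_mx f d) *m (P *m Q^T) *m
       (diag_mx (map_mx g e) *m (P *m Q^T)^T)).
  by rewrite -!mulmxA mxtrace_mulC trmx_mul trmxK !mulmxA.
rewrite mul_diag_mx mul_diag_mx; apply: eq_bigr => i _; rewrite mxE.
by apply: eq_bigr => j _; rewrite !mxE; ring.
Qed.

Lemma sum_sqr_row_orthogonal P Q i : P *m P^T = 1%:M -> Q^T *m Q = 1%:M ->
  \sum_j (P *m Q^T) i j ^+ 2 = 1.
Proof.
move=> PP QQ; transitivity (((P *m Q^T) *m (P *m Q^T)^T) i i).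
  by rewrite mxE; apply: eq_bigr => j _; rewrite [_^T _ _]mxE expr2.
by rewrite trmx_mul trmxK mulmxA -(mulmxA P) QQ mulmx1 PP mxE eqxx.
Qed.

Lemma trace_sqr_diff P d A Q e B :
  diagonalizes P d A -> diagonalizes Q e B ->
  \tr ((A - B) *m (A - B)) =
  \sum_i \sum_j (P *m Q^T) i j ^+ 2 * (d 0 i - e 0 j) ^+ 2.
Proof.
move=> PdA QeB; have symA := diagonalizes_sym PdA.
have symB := diagonalizes_sym QeB.
have -> : \tr ((A - B) *m (A - B)) =
  \tr (mxfun (fun x => x * x) A *m mxfun (fun=> 1) B)
  - 2%:R * \tr (mxfun id A *m mxfun id B)
  + \tr (mxfun (fun=> 1) A *m mxfun (fun x => x * x) B).
  rewrite !mxfun_cst // mul1mx mulmx1 -!mxfunM // !mxfun_id //.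
  by rewrite mulmxBl !mulmxBr !raddfB /= (mxtrace_mulC B A); ring.
rewrite !(trace_mxfun_mul _ _ PdA QeB) mulr_sumr -sumrB -big_split /=.
apply: eq_bigr => i _; rewrite mulr_sumr -sumrB -big_split /=.
by apply: eq_bigr => j _; ring.
Qed.

(** In the eigenbases of [A] and [B] the Taylor remainder of the trace function
    is an average, with the same weights as [tr (A - B)^2], of the scalar
    Taylor remainders at pairs of eigenvalues. *)
Lemma trace_taylor_remainder P d A Q e B f g :
  diagonalizes P d A -> diagonalizes Q e B ->
  \tr (mxfun f A) - \tr (mxfun f B) - \tr ((A - B) *m mxfun g B) =
  \sum_i \sum_j (P *m Q^T) i j ^+ 2 *
    (f (d 0 i) - f (e 0 j) - (d 0 i - e 0 j) * g (e 0 j)).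
Proof.
move=> PdA QeB; have symA := diagonalizes_sym PdA.
have symB := diagonalizes_sym QeB.
have -> : \tr (mxfun f A) - \tr (mxfun f B) - \tr ((A - B) *m mxfun g B) =
  \tr (mxfun f A *m mxfun (fun=> 1) B) - \tr (mxfun (fun=> 1) A *m mxfun f B)
  - (\tr (mxfun id A *m mxfun g B)
     - \tr (mxfun (fun=> 1) A *m mxfun (fun x => x * g x) B)).
  rewrite !mxfun_cst // !mul1mx mulmx1 -(mxfunM id) // !mxfun_id //.
  by rewrite mulmxBl raddfB.
rewrite !(trace_mxfun_mul _ _ PdA QeB) -!sumrB.
apply: eq_bigr => i _; rewrite -!sumrB.
by apply: eq_bigr => j _; ring.
Qed.

Lemma trace_taylor_le P d A Q e B f g K :
  diagonalizes P d A -> diagonalizes Q e B ->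
  (forall i j, `|f (d 0 i) - f (e 0 j) - (d 0 i - e 0 j) * g (e 0 j)| <=
     K * (d 0 i - e 0 j) ^+ 2) ->
  `|\tr (mxfun f A) - \tr (mxfun f B) - \tr ((A - B) *m mxfun g B)| <=
  K * \tr ((A - B) *m (A - B)).
Proof.
move=> PdA QeB fgK; rewrite (trace_taylor_remainder _ _ PdA QeB).
rewrite (trace_sqr_diff PdA QeB) mulr_sumr.
apply: le_trans (ler_norm_sum _ _ _) _; apply: ler_sum => i _.
rewrite mulr_sumr; apply: le_trans (ler_norm_sum _ _ _) _.
apply: ler_sum => j _; rewrite normrM ger0_norm ?sqr_ge0 // mulrCA.
by rewrite ler_wpM2l ?sqr_ge0.
Qed.

(** The weights sum to 1 in each row, so an eigenvalue of [A] at distance at least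
    [m] from the whole spectrum of [B] would make [tr (A - B)^2] at least
    [m ^+ 2]. *)
Lemma eig_gt_near P d A Q e B (m : R) : 0 < m ->
  diagonalizes P d A -> diagonalizes Q e B -> (forall j, 2 * m <= e 0 j) ->
  \tr ((A - B) *m (A - B)) < m ^+ 2 -> forall i, m < d 0 i.
Proof.
move=> m_gt0 PdA QeB e_ge tr_lt i; rewrite ltNge; apply/negP => di_le.
move: tr_lt; rewrite (trace_sqr_diff PdA QeB) ltNge => /negP; apply.
have S1 := sum_sqr_row_orthogonal i PdA.1 (diagonalizesVl QeB).
rewrite (bigD1 i) //= -[leLHS]addr0; apply: lerD; last first.
  by rewrite !sumr_ge0 // => k _; rewrite sumr_ge0 // => j _;
    rewrite mulr_ge0 ?sqr_ge0.
rewrite -[leLHS]mul1r -S1 mulr_suml; apply: ler_sum => j _.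
rewrite ler_wpM2l ?sqr_ge0 // -[leRHS]sqrrN ler_sqr ?nnegrE //.
all: have := e_ge j; lra.
Qed.

(** The derivative of [A |-> tr (f A)] on symmetric matrices near a positive
    definite [B] is [H |-> tr (H f'(B))], with a quadratic remainder. *)
Lemma trace_fun_taylor Q e B f g : diagonalizes Q e B ->
  (forall j, 0 < e 0 j) ->
  (forall m b, 0 < m -> m <= b -> exists K, forall a, m <= a ->
     `|f a - f b - (a - b) * g b| <= K * (a - b) ^+ 2) ->
  exists K r, [/\ 0 <= K, 0 < r & forall A, A^T = A ->
    \tr ((A - B) *m (A - B)) < r ->
    `|\tr (mxfun f A) - \tr (mxfun f B) - \tr ((A - B) *m mxfun g B)| <=
    K * \tr ((A - B) *m (A - B))].
Proof.
move=> QeB e_gt0 fg.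
have [m m_gt0 me] : exists2 m, 0 < m & forall j, 2 * m <= e 0 j.
  (* [1 / (1 + s)] is below every eigenvalue, also when there is none. *)
  pose s := \sum_j (e 0 j)^-1.
  have s_ge0 : 0 <= s by rewrite sumr_ge0 // => j _; rewrite invr_ge0 ltW.
  exists ((2 * (1 + s))^-1) => [|j]; first by rewrite invr_gt0; lra.
  rewrite invfM mulrA divff ?pnatr_eq0 // mul1r.
  rewrite -[leRHS]invrK lef_pV2 ?posrE ?invr_gt0 //; last by lra.
  rewrite /s (bigD1 j) //= addrCA lerDl addr_ge0 //.
  by rewrite sumr_ge0 // => k _; rewrite invr_ge0 ltW.
(* The spectrum of any nearby [A] stays above [m], where the scalar bounds hold. *)
have me' j : m <= e 0 j by apply: le_trans (me j); lra.
have /fin_all_exists [K KP] j := fg m (e 0 j) m_gt0 (me' j).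
exists (\sum_j `|K j|), (m ^+ 2); split; first by rewrite sumr_ge0.
  by rewrite exprn_gt0.
move=> A /sym_diagonalizes[P [d PdA]] tr_lt.
have m_lt := eig_gt_near m_gt0 PdA QeB me tr_lt.
apply: trace_taylor_le PdA QeB _ => i j.
apply: le_trans (KP j _ (ltW (m_lt i))) _; rewrite ler_wpM2r ?sqr_ge0 //.
rewrite (bigD1 j) //= (le_trans (ler_norm _)) // lerDl.
by rewrite sumr_ge0.
Qed.

End TraceFunctions.


(** * Estimates for the logarithm *)

Section LogEstimates.
Context {R : realType}.
Implicit Types a b m x y z : R.

Lemma lnB_le a b : 0 < a -> 0 < b -> ln a - ln b <= (a - b) / b.
Proof.
move=> a_gt0 b_gt0; rewrite -ln_div ?posrE // mulrBl divff ?gt_eqF //.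
rewrite -[X in ln X](subrK 1) addrC; apply: le_trans (le_ln1Dx _) _ => //.
by rewrite ltrBrDl subrr divr_gt0.
Qed.

Lemma lnB_lt a b : 0 < a -> 0 < b -> a != b -> ln a - ln b < (a - b) / b.
Proof.
move=> a_gt0 b_gt0 ab; rewrite -ln_div ?posrE // mulrBl divff ?gt_eqF //.
have ab_gt0 : 0 < a / b by rewrite divr_gt0.
have ln_neq0 : ln (a / b) != 0.
  rewrite ln_eq0 //; apply: contra_neq ab => ab1.
  by rewrite -[a](divfK (lt0r_neq0 b_gt0)) ab1 mul1r.
by rewrite ltrBrDl -[ltRHS](lnK ab_gt0) expR_gt1Dx.
Qed.

Lemma lnB_ge a b : 0 < a -> 0 < b -> (a - b) / a <= ln a - ln b.
Proof.
by move=> a_gt0 b_gt0; rewrite -lerN2 opprB -mulNr opprB lnB_le.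
Qed.

Lemma lnB_gt a b : 0 < a -> 0 < b -> a != b -> (a - b) / a < ln a - ln b.
Proof.
move=> a_gt0 b_gt0 ab.
by rewrite -ltrN2 opprB -mulNr opprB lnB_lt // eq_sym.
Qed.

(** The remainder is squeezed between 0 and the difference of the slopes [1 / b]
    and [1 / a] of the two tangents, times [a - b]. *)
Lemma ln_taylor_le m a b : 0 < m -> m <= a -> m <= b ->
  `|ln a - ln b - (a - b) / b| <= m ^- 2 * (a - b) ^+ 2.
Proof.
move=> m_gt0 ma mb.
have a_gt0 := lt_le_trans m_gt0 ma; have b_gt0 := lt_le_trans m_gt0 mb.
rewrite ler0_norm ?subr_le0 ?lnB_le // opprB.
apply: (@le_trans _ _ ((a - b) / b - (a - b) / a)).
  by rewrite lerD2l lerN2 lnB_ge.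
have -> : (a - b) / b - (a - b) / a = (a * b)^-1 * (a - b) ^+ 2.
  by field; rewrite !gt_eqF.
rewrite ler_wpM2r ?sqr_ge0 // lef_pV2 ?posrE ?exprn_gt0 ?mulr_gt0 //.
by rewrite expr2 ler_pM // ltW.
Qed.

Lemma sqr_lnB_le m a b : 0 < m -> m <= a -> m <= b ->
  (ln a - ln b) ^+ 2 <= m ^- 2 * (a - b) ^+ 2.
Proof.
move=> m_gt0; wlog ba : a b / b <= a => [hwlog ma mb|ma mb].
  have [/hwlog|/ltW/hwlog/(_ mb ma)] := leP b a; first exact.
  by rewrite -(sqrrN (ln b - ln a)) -(sqrrN (b - a)) !opprB.
have a_gt0 := lt_le_trans m_gt0 ma; have b_gt0 := lt_le_trans m_gt0 mb.
rewrite -exprVn -exprMn ler_sqr ?nnegrE; last 2 first.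
- by rewrite subr_ge0 ler_ln.
- by rewrite mulr_ge0 ?invr_ge0 ?subr_ge0 // ltW.
apply: le_trans (lnB_le a_gt0 b_gt0) _.
by rewrite mulrC ler_wpM2r ?subr_ge0 // lef_pV2.
Qed.

Lemma half_ln_taylor m b : 0 < m -> m <= b -> exists K, forall a, m <= a ->
  `|ln a / 2 - ln b / 2 - (a - b) * (2 * b)^-1| <= K * (a - b) ^+ 2.
Proof.
move=> m_gt0 mb; exists (m ^- 2) => a ma.
have b_gt0 := lt_le_trans m_gt0 mb.
have -> : ln a / 2 - ln b / 2 - (a - b) * (2 * b)^-1 =
    (ln a - ln b - (a - b) / b) * 2^-1 by field; rewrite gt_eqF.
have := ln_taylor_le m_gt0 ma mb.
have : 0 <= `|ln a - ln b - (a - b) / b| by [].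
by rewrite normrM (@ger0_norm _ 2^-1) ?invr_ge0 //; lra.
Qed.

(** Squares: [u^2 - v^2 - 2 v (u - v) = (u - v)^2], and the error of replacing
    [u - v] by its linear part is controlled by [ln_taylor_le]. *)
Lemma sqr_half_ln_taylor m b : 0 < m -> m <= b -> exists K, forall a, m <= a ->
  `|(ln a / 2) ^+ 2 - (ln b / 2) ^+ 2 - (a - b) * (ln b / 2 / b)|
    <= K * (a - b) ^+ 2.
Proof.
move=> m_gt0 mb; exists (m ^- 2 * (1 + `|ln b|)) => a ma.
have b_gt0 := lt_le_trans m_gt0 mb.
have -> : (ln a / 2) ^+ 2 - (ln b / 2) ^+ 2 - (a - b) * (ln b / 2 / b) =
    ((ln a - ln b) ^+ 2 / 2 + (ln a - ln b - (a - b) / b) * ln b) / 2.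
  by field; rewrite gt_eqF.
rewrite normrM (@ger0_norm _ 2^-1) ?invr_ge0 //.
apply: (@le_trans _ _ (m ^- 2 * (a - b) ^+ 2 * (1 + `|ln b|) / 2)); last first.
  have : 0 <= m ^- 2 * (a - b) ^+ 2 * (1 + `|ln b|).
    rewrite mulr_ge0 ?addr_ge0 // mulr_ge0 ?sqr_ge0 // invr_ge0.
    by rewrite exprn_ge0 // ltW.
  by rewrite [leRHS]mulrAC; lra.
rewrite ler_pM2r ?invr_gt0 // mulrDr mulr1; apply: le_trans (ler_normD _ _) _.
apply: lerD; last by rewrite normrM ler_wpM2r // ln_taylor_le.
rewrite ger0_norm; last by rewrite divr_ge0 ?sqr_ge0.
have := sqr_lnB_le m_gt0 ma mb; have := sqr_ge0 (ln a - ln b); lra.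
Qed.

(** Interpolating [ln] by [a0 + a1 t + c / t] at [x < y < z], [a1] is the second
    divided difference of the convex function [t ln t], and [c] that of the
    concave function [- s ln s] at the points [s = 1 / t], whence the signs. If
    two of the points coincide, the chord suffices. *)
Lemma ln_interpolation_sorted x y z : 0 < x -> x <= y -> y <= z -> x < z ->
  exists a0 a1 c, [/\ c <= 0, 0 <= a1, c < 0 \/ 0 < a1 &
    [/\ ln x = a0 + a1 * x + c / x, ln y = a0 + a1 * y + c / y
      & ln z = a0 + a1 * z + c / z]].
Proof.
move=> x_gt0 xy yz xz; have y_gt0 := lt_le_trans x_gt0 xy.
have z_gt0 := lt_le_trans y_gt0 yz.
have zx_gt0 : 0 < z - x by rewrite subr_gt0.
have [y_end|] := boolP ((y == x) || (y == z)).
  pose a1 := (ln z - ln x) / (z - x).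
  have a1_gt0 : 0 < a1 by rewrite divr_gt0 // subr_gt0 ltr_ln.
  exists (ln x - a1 * x), a1, 0; split; [by []|exact: ltW|by right|].
  have Hx : ln x = ln x - a1 * x + a1 * x + 0 / x by rewrite mul0r; ring.
  have Hz : ln z = ln x - a1 * x + a1 * z + 0 / z.
    by rewrite mul0r /a1; field; rewrite gt_eqF.
  by split=> //; case/orP: y_end => /eqP ->.
rewrite negb_or => /andP[yx yz'].
have {xy} xy : x < y by rewrite lt_def yx.
have {yz} yz : y < z by rewrite lt_def eq_sym yz'.
have yx_gt0 : 0 < y - x by rewrite subr_gt0.
have zy_gt0 : 0 < z - y by rewrite subr_gt0.
(* By strict concavity the chord slopes [p] and [q] compare strictly with the
   tangent slopes [1 / x], [1 / y] and [1 / z]. *)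
pose p := (ln y - ln x) / (y - x); pose q := (ln z - ln y) / (z - y).
have yp : 1 < y * p.
  rewrite /p mulrA ltr_pdivlMr // mul1r mulrC -ltr_pdivrMr //.
  by rewrite lnB_gt.
have xp : x * p < 1.
  rewrite /p mulrA ltr_pdivrMr // mul1r mulrC -ltr_pdivlMr //.
  by rewrite lnB_lt.
have zq : 1 < z * q.
  rewrite /q mulrA ltr_pdivlMr // mul1r mulrC -ltr_pdivrMr //.
  by rewrite lnB_gt // eq_sym.
have yq : y * q < 1.
  rewrite /q mulrA ltr_pdivrMr // mul1r mulrC -ltr_pdivlMr //.
  by rewrite lnB_lt // eq_sym.
have qp : q < p by rewrite -(ltr_pM2l y_gt0) (lt_trans yq).
pose a1 := (z * q - x * p) / (z - x).
pose c := - (x * y * z * (p - q) / (z - x)).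
have a1_gt0 : 0 < a1 by rewrite divr_gt0 // subr_gt0 (lt_trans xp).
have c_lt0 : c < 0.
  by rewrite oppr_lt0 divr_gt0 // !mulr_gt0 // subr_gt0.
exists (ln y - a1 * y - c / y), a1, c; split; [exact: ltW|exact: ltW|by left|].
have [x0 y0 z0] : [/\ x != 0, y != 0 & z != 0] by rewrite !gt_eqF.
split.
- rewrite -[LHS](subKr (ln y)) -[X in _ - X](divfK (lt0r_neq0 yx_gt0)) -/p.
  by rewrite /a1 /c; field; rewrite x0 y0 gt_eqF.
- by ring.
- rewrite -[LHS](subrK (ln y)) -[X in X + _](divfK (lt0r_neq0 zy_gt0)) -/q.
  by rewrite /a1 /c; field; rewrite z0 y0 gt_eqF.
Qed.

Lemma ln_interpolation x y z : 0 < x -> 0 < y -> 0 < z ->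
  ~ (x = y /\ y = z) ->
  exists a0 a1 c, [/\ c <= 0, 0 <= a1, c < 0 \/ 0 < a1 &
    [/\ ln x = a0 + a1 * x + c / x, ln y = a0 + a1 * y + c / y
      & ln z = a0 + a1 * z + c / z]].
Proof.
wlog xy : x y z / x <= y => [hwlog|].
  have [xy|/ltW yx] := leP x y; first exact: hwlog.
  move=> x0 y0 z0 ne; have [|a0 [a1 [c [? ? ? [? ? ?]]]]] :=
    hwlog y x z yx y0 x0 z0; first by case=> yE xE; apply: ne; rewrite yE xE.
  by exists a0, a1, c.
wlog yz : x y z xy / y <= z => [hwlog|].
  have [yz|/ltW zy] := leP y z; first exact: hwlog.
  move=> x0 y0 z0 ne; have [xz|/ltW zx] := leP x z.
    have [|a0 [a1 [c [? ? ? [? ? ?]]]]] := hwlog x z y xz zy x0 z0 y0.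
      by case=> xE zE; apply: ne; rewrite xE zE.
    by exists a0, a1, c.
  have [|a0 [a1 [c [? ? ? [? ? ?]]]]] := hwlog z x y zx xy z0 x0 y0.
    by case=> zE xE; apply: ne; rewrite zE xE.
  by exists a0, a1, c.
move=> x0 _ _ ne; apply: ln_interpolation_sorted => //.
rewrite lt_neqAle (le_trans xy yz) andbT; apply/eqP => xz.
by apply: ne; split; apply/eqP; rewrite eq_le ?xy ?yz /= ?xz // -xz.
Qed.

End LogEstimates.

(** * Differentiability *)

Section Differentials.
Context {R : realType}.
Implicit Types U V W : normedModType R.

Lemma is_diff_eps V W (f : V -> W) (x : V) (L : {linear V -> W}) :
  continuous L ->
  (forall eps : R, 0 < eps -> \forall h \near (0 : V),
     `|f (h + x) - f x - L h| <= eps * `|h|) ->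
  is_diff x f L.
Proof.
move=> Lc fL.
have expansion : f \o shift x = cst (f x) + L +o_ (0 : V) id.
  apply/eqaddoP => eps eps_gt0; have := fL _ eps_gt0.
  by apply: filterS => h; rewrite opprD addrA.
have dfL : 'd f x = L :> (V -> W) by exact: diff_unique.
by split => //; apply/diff_locallyP; rewrite dfL.
Qed.

Lemma is_diff_expansion V W (f df : V -> W) (x : V) : is_diff x f df ->
  forall eps : R, 0 < eps -> \forall h \near (0 : V),
     `|f (h + x) - f x - df h| <= eps * `|h|.
Proof.
move=> fdf eps eps_gt0.
have /diff_locally/eqaddoP/(_ _ eps_gt0) : differentiable f x by [].
by rewrite diff_val; apply: filterS => h; rewrite opprD addrA.
Qed.

Lemma is_diff_near_eq V W (f g df : V -> W) (x : V) :
  (\forall y \near x, f y = g y) -> is_diff x f df -> is_diff x g df.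
Proof.
move=> fg fdf; have dfE : 'd f x = df :> (V -> W) := diff_val.
rewrite -dfE; apply: is_diff_eps.
  exact: diff_continuous.
move=> eps /(is_diff_expansion fdf); rewrite -dfE.
have gx : f x = g x := nbhs_singleton fg.
apply: filter_app.
move: fg; rewrite (near_shift 0) subr0.
by apply: filterS => h /= ->; rewrite gx.
Qed.

(** The base point of the relative differential is the limit of the filter of
    relative neighbourhoods of [y], which is [y] because [y] lies in [D]. *)
Lemma differentiable_within_expansion U W (w : U -> W) (D : set U) (y : U) :
  D y -> differentiable w (within D (nbhs y)) ->
  continuous ('d w (within D (nbhs y))) /\
  forall eps : R, 0 < eps -> \forall z \near y, D z ->
     `|w z - w y - 'd w (within D (nbhs y)) (z - y)| <= eps * `|z - y|.
Proof.
move=> Dy; set F := within D (nbhs y).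
have FF : ProperFilter F.
  apply: Build_ProperFilter_ex => P /= FP.
  by exists y; apply: (nbhs_singleton FP).
have limF : lim F = y.
  by apply: (@cvg_lim _ _ _ F _ id) => //; apply: cvg_within.
move=> [[dwc w_exp]]; split=> // eps eps_gt0.
have /eqaddoP/(_ _ eps_gt0) := w_exp; rewrite limF.
by apply: filterS => z; rewrite !fctE opprD addrA.
Qed.

(** The outer function is only controlled on [D], where one-sided expansions at
    boundary points are enough since the inner function takes its values
    there. *)
Lemma is_diff_comp_within V U W (G dG : V -> U) (w : U -> W) (D : set U) (x : V) :
  is_diff x G dG -> (\forall z \near x, D (G z)) ->
  differentiable w (within D (nbhs (G x))) ->
  is_diff x (w \o G) ('d w (within D (nbhs (G x))) \o dG).
Proof.
move=> GdG DG w_diff; have Dx : D (G x) := nbhs_singleton DG.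
have [dwc w_exp] := differentiable_within_expansion Dx w_diff.
set L := 'd w (within D (nbhs (G x))) in dwc w_exp *.
have dGE : 'd G x = dG :> (V -> U) := diff_val.
have G_diff : differentiable G x by [].
rewrite -dGE; apply: is_diff_eps.
  move=> v; apply: continuous_comp; first exact: (diff_continuous G_diff).
  exact: dwc.
have /linear_bounded_continuous/linear_boundedP Lb := dwc.
have /linear_bounded_continuous/linear_boundedP dGb := diff_continuous G_diff.
have [k1 k1_gt0 Lk1] : exists2 k1 : R, 0 < k1 & forall u, `|L u| <= k1 * `|u|.
  exact: pinfty_ex_gt0 Lb.
have [k2 k2_gt0 dGk2] : exists2 k2 : R,
    0 < k2 & forall v, `|'d G x v| <= k2 * `|v|.
  exact: pinfty_ex_gt0 dGb.
move=> eps eps_gt0.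
pose e2 : R := eps / (2 * k1).
have e2_gt0 : 0 < e2 by rewrite divr_gt0 // mulr_gt0.
pose e1 : R := eps / (2 * (k2 + e2)).
have e1_gt0 : 0 < e1 by rewrite divr_gt0 // mulr_gt0 // addr_gt0.
have G_exp := is_diff_expansion GdG e2_gt0.
have Gcont : (G \o shift x) h @[h --> (0 : V)] --> G x.
  have := differentiable_continuous G_diff.
  by rewrite cvg_comp_shift add0r.
have w_near : \forall h \near (0 : V), D (G (h + x)) ->
    `|w (G (h + x)) - w (G x) - L (G (h + x) - G x)| <= e1 * `|G (h + x) - G x|.
  exact: Gcont _ (w_exp _ e1_gt0).
have D_near : \forall h \near (0 : V), D (G (h + x)).
  by move: DG; rewrite (near_shift 0) subr0.
apply: filterS3 G_exp w_near D_near => h; rewrite -dGE => Gh wh Dh.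
have GhB : `|G (h + x) - G x| <= (k2 + e2) * `|h|.
  rewrite -[X in `|X|](subrK ('d G x h)) mulrDl addrC.
  by apply: le_trans (ler_normD _ _) _; apply: lerD.
have -> : (w \o G) (h + x) - (w \o G) x - (L \o 'd G x) h =
    (w (G (h + x)) - w (G x) - L (G (h + x) - G x)) +
    L (G (h + x) - G x - 'd G x h).
  by rewrite [L (_ - 'd G x h)]linearB addrA subrK.
apply: le_trans (ler_normD _ _) _.
have -> : eps * `|h| = e1 * ((k2 + e2) * `|h|) + k1 * (e2 * `|h|).
  have k2e2 : k2 + e2 != 0 by rewrite gt_eqF // addr_gt0.
  have k1e2 : k1 * (e2 * `|h|) = eps / 2 * `|h|.
    by rewrite /e2; field; rewrite gt_eqF.
  by rewrite k1e2 /e1; field.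
apply: lerD.
  by apply: le_trans (wh Dh) _; rewrite ler_pM2l.
by apply: le_trans (Lk1 _) _; rewrite ler_pM2l.
Qed.

End Differentials.

Section GradientOfTraceFunctions.
Context {R : realType} {n : nat}.
Implicit Types (A B M F : 'M[R]_n).

Lemma mx_entry_le_norm A i j : `|A i j| <= `|A|.
Proof.
rewrite [leRHS]/Num.Def.normr /= mx_normrE.
by apply/bigmax_geP; right => /=; exists (i, j).
Qed.

Lemma mx_norm_le A (c : R) : 0 <= c -> (forall i j, `|A i j| <= c) -> `|A| <= c.
Proof.
move=> c_ge0 Ac; rewrite [leLHS]/Num.Def.normr /= mx_normrE.
by apply: bigmax_le => // -[i j] _; apply: Ac.
Qed.

Lemma trmx_norm_le A : `|A^T| <= `|A|.
Proof. by apply: mx_norm_le => // i j; rewrite mxE mx_entry_le_norm. Qed.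

Lemma mulmx_norm_le A B : `|A *m B| <= n%:R * (`|A| * `|B|).
Proof.
apply: mx_norm_le => [|i j]; first by rewrite !mulr_ge0.
rewrite mxE; apply: le_trans (ler_norm_sum _ _ _) _.
rewrite mulr_natl -[X in _ *+ X]card_ord -sumr_const; apply: ler_sum => k _.
by rewrite normrM ler_pM // mx_entry_le_norm.
Qed.

Lemma trace_norm_le A : `|\tr A| <= n%:R * `|A|.
Proof.
apply: le_trans (ler_norm_sum _ _ _) _.
rewrite mulr_natl -[X in _ *+ X]card_ord -sumr_const; apply: ler_sum => k _.
exact: mx_entry_le_norm.
Qed.

(** The linear form represented by [M] for the Frobenius inner product. *)
Definition frob_form M (E : 'M[R]_n) : R := \tr (M^T *m E).

Fact frob_form_is_linear M : linear (frob_form M : 'M[R]_n -> R^o).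
Proof.
by move=> a A B; rewrite /frob_form mulmxDr -scalemxAr mxtraceD mxtraceZ.
Qed.

HB.instance Definition _ M :=
  GRing.isLinear.Build R 'M[R]_n R^o _ (frob_form M) (frob_form_is_linear M).

Lemma frob_form_le M E : `|frob_form M E| <= n%:R * (n%:R * `|M|) * `|E|.
Proof.
apply: le_trans (trace_norm_le _) _; rewrite -mulrA ler_wpM2l //.
apply: le_trans (mulmx_norm_le _ _) _; rewrite -mulrA ler_wpM2l //.
by rewrite ler_wpM2r // trmx_norm_le.
Qed.

Lemma frob_form_continuous M : continuous (frob_form M : 'M[R]_n -> R).
Proof.
apply: (@bounded_linear_continuous R 'M[R]_n R^o (frob_form M)).
apply/linear_boundedP; near=> r => E.
by apply: le_trans (frob_form_le M E) _; rewrite ler_wpM2r.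
Unshelve. all: by end_near. Qed.

Lemma frob_formD A B E : frob_form (A + B) E = frob_form A E + frob_form B E.
Proof. by rewrite /frob_form linearD mulmxDl mxtraceD. Qed.

Lemma frob_formZ a A E : frob_form (a *: A) E = a * frob_form A E.
Proof. by rewrite /frob_form linearZ -scalemxAl mxtraceZ. Qed.

Lemma frob_form_delta M i j : frob_form M (delta_mx i j) = M i j.
Proof.
rewrite /frob_form /mxtrace (bigD1 j) //= big1 ?addr0 => [|k /negbTE kj].
  rewrite mxE (bigD1 i) //= big1 ?addr0 => [|l /negbTE li].
    by rewrite !mxE !eqxx mulr1.
  by rewrite !mxE li mulr0.
by rewrite mxE big1 // => l _; rewrite !mxE kj andbF mulr0.
Qed.

(** Chain rule for [A |-> tr (f A)] and [F |-> F^T F]: as [f' A] is symmetric,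
    the two first-order terms [F^T E] and [E^T F] contribute equally. *)
Lemma is_diff_trace_fun (f g : R -> R) Q e F :
  diagonalizes Q e (F^T *m F) -> (forall j, 0 < e 0 j) ->
  (forall m b, 0 < m -> m <= b -> exists K, forall a, m <= a ->
     `|f a - f b - (a - b) * g b| <= K * (a - b) ^+ 2) ->
  is_diff F (fun X => \tr (mxfun f (X^T *m X)) : R)
    (frob_form (2%:R *: (F *m mxfun g (F^T *m F)))).
Proof.
move=> QeC e_gt0 fg; set C := F^T *m F; set G := mxfun g C.
have symC : C^T = C by rewrite trmx_mul trmxK.
have symG : G^T = G by exact: mxfun_sym.
have [K [r [K_ge0 r_gt0 taylor]]] := trace_fun_taylor QeC e_gt0 fg.
pose N : R := n%:R.
have N_ge0 : 0 <= N by [].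
(* With [H] the increment of [F^T F], for [`|h| <= 1]: [`|H| <= c1 * `|h|],
   [tr H^2 <= c2 * `|h|^2], and [c3 * `|h|^2] bounds the second-order term
   [tr (h^T h G)]. *)
pose c1 := N * (2%:R * `|F| + 1).
have c1_ge0 : 0 <= c1 by rewrite mulr_ge0 // addr_ge0 // mulr_ge0.
pose c2 := N * (N * c1 ^+ 2).
have c2_ge0 : 0 <= c2 by rewrite !mulr_ge0 // sqr_ge0.
pose c3 := N * (N * (N * `|G|)).
have c3_ge0 : 0 <= c3 by rewrite !mulr_ge0.
apply: is_diff_eps; first exact: frob_form_continuous.
move=> eps eps_gt0.
pose delta := Num.min 1 (Num.min (r / (c2 + 1)) (eps / (K * c2 + c3 + 1))).
have Kc_ge0 : 0 <= K * c2 + c3 by rewrite addr_ge0 // mulr_ge0.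
have delta_gt0 : 0 < delta.
  by rewrite !lt_min ltr01 !divr_gt0 // ltr_wpDl.
have : \forall h \near (0 : 'M[R]_n), `|h| < delta.
  by apply/nbhs_norm0P; exists delta.
apply: filterS => h; rewrite !lt_min => /and3P[h1 hr heps].
pose H := F^T *m h + h^T *m F + h^T *m h.
have CH : (h + F)^T *m (h + F) = C + H.
  rewrite [(h + F)^T]linearD /= mulmxDl !mulmxDr /H /C.
  by rewrite [LHS]addrC (addrC (F^T *m h) (F^T *m F)) -!addrA (addrC (h^T *m h)).
have H_le : `|H| <= c1 * `|h|.
  have hT := trmx_norm_le h; have FT := trmx_norm_le F.
  apply: le_trans (ler_normD _ _) _.
  have -> : c1 * `|h| = (N * (`|F| * `|h|) + N * (`|h| * `|F|)) + N * (1 * `|h|).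
    by rewrite /c1; ring.
  apply: lerD; first (apply: le_trans (ler_normD _ _) _; apply: lerD).
  - by apply: le_trans (mulmx_norm_le _ _) _; rewrite ler_wpM2l // ler_wpM2r.
  - by apply: le_trans (mulmx_norm_le _ _) _; rewrite ler_wpM2l // ler_wpM2r.
  - apply: le_trans (mulmx_norm_le _ _) _; rewrite ler_wpM2l // ler_wpM2r //.
    exact: le_trans hT (ltW h1).
have HH_le : \tr (H *m H) <= c2 * `|h| ^+ 2.
  apply: le_trans (ler_norm _) _; apply: le_trans (trace_norm_le _) _.
  have -> : c2 * `|h| ^+ 2 = N * (N * (c1 * `|h|) ^+ 2) by rewrite /c2; ring.
  rewrite ler_wpM2l //; apply: le_trans (mulmx_norm_le _ _) _.
  by rewrite ler_wpM2l // expr2 ler_pM.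
have hh_le : `|h| ^+ 2 <= `|h| by rewrite expr2 ler_piMr // ltW.
have HH_r : \tr (H *m H) < r.
  apply: le_lt_trans HH_le _; apply: le_lt_trans (ler_wpM2l c2_ge0 hh_le) _.
  move: hr; rewrite ltr_pdivlMr ?ltr_wpDl // mulrDr mulr1 [_ * c2]mulrC.
  by apply: le_lt_trans; rewrite lerDl.
have hhG_le : `|\tr (h^T *m h *m G)| <= c3 * `|h| ^+ 2.
  have -> : c3 * `|h| ^+ 2 = N * (N * ((N * (`|h| * `|h|)) * `|G|)).
    by rewrite /c3; ring.
  apply: le_trans (trace_norm_le _) _; rewrite ler_wpM2l //.
  apply: le_trans (mulmx_norm_le _ _) _; rewrite ler_wpM2l // ler_wpM2r //.
  apply: le_trans (mulmx_norm_le _ _) _; rewrite ler_wpM2l // ler_wpM2r //.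
  exact: trmx_norm_le.
have symCH : (C + H)^T = C + H by rewrite -CH trmx_mul trmxK.
have := taylor _ symCH; rewrite [C + H - C]addrC addKr => /(_ HH_r) tay.
have -> : \tr (mxfun f ((h + F)^T *m (h + F))) - \tr (mxfun f C) -
    frob_form (2%:R *: (F *m G)) h =
  (\tr (mxfun f (C + H)) - \tr (mxfun f C) - \tr (H *m G)) + \tr (h^T *m h *m G).
  have hFG : \tr (h^T *m F *m G) = frob_form (F *m G) h.
    by rewrite -mxtrace_tr /frob_form -mulmxA trmx_mul trmxK.
  have FhG : \tr (F^T *m h *m G) = frob_form (F *m G) h.
    by rewrite /frob_form trmx_mul symG mxtrace_mulC mulmxA.
  rewrite CH frob_formZ /H !mulmxDl !mxtraceD hFG FhG; ring.
apply: le_trans (ler_normD _ _) _.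
apply: (@le_trans _ _ ((K * c2 + c3) * `|h| ^+ 2)).
  rewrite mulrDl; apply: lerD => //; apply: le_trans tay _.
  by rewrite -mulrA ler_wpM2l.
rewrite expr2 mulrA ler_wpM2r //.
move: heps; rewrite ltr_pdivlMr ?ltr_wpDl // mulrDr mulr1 mulrC => /ltW.
by apply: le_trans; rewrite lerDl.
Qed.

End GradientOfTraceFunctions.

(** * The Cauchy stress of the energy *)

Section Stress.
Context {R : realType}.
Implicit Types (A B C F M Q : 'M[R]_3) (w : R * R -> R).

Lemma sympos_gram F : F \in unitmx -> sympos (F^T *m F).
Proof.
move=> F_unit; split.
  by apply/symmetricmxP; rewrite trmx_mul trmxK.
move=> v v_neq0.
have -> : v *m (F^T *m F) *m v^T = (v *m F^T) *m (v *m F^T)^T.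
  by rewrite trmx_mul trmxK !mulmxA.
rewrite lt_def mul_row_tr_ge0 mul_row_tr_eq0 andbT.
apply: contra_neq v_neq0 => vF0.
have FT_unit : F^T \in unitmx by rewrite unitmx_tr.
by rewrite -(mulmxK FT_unit v) vF0 mul0mx.
Qed.

Lemma GLpos_unit F : GLpos F -> F \in unitmx.
Proof. by move=> F_pos; rewrite unitmxE unitfE gt_eqF. Qed.

Lemma det_continuous : continuous (fun A : 'M[R]_3 => \det A).
Proof.
move=> A; have FA : Filter (nbhs A) by exact: nbhs_filter.
apply: (@cvg_big R _ +%R 0 xpredT _ _ (nbhs A) _ _ _ FA) => [|s _].
  exact: add_continuous.
apply: cvgM; first exact: cvg_cst.
apply: (@cvg_big R _ *%R 1 xpredT _ _ (nbhs A) _ _ _ FA) => [|i _].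
  exact: mul_continuous.
exact: coord_continuous.
Qed.

Lemma near_unitmx F : F \in unitmx -> \forall A \near F, A \in unitmx.
Proof.
rewrite unitmxE unitfE => detF.
have : \forall A \near F, \det A != 0.
  exact: (cvgr_neq0 (\det F) (@det_continuous F)).
by apply: filterS => A detA; rewrite unitmxE unitfE.
Qed.

Lemma ln_sqrt (x : R) : 0 < x -> ln (Num.sqrt x) = ln x / 2.
Proof.
move=> x_gt0; rewrite -[in RHS](sqr_sqrtr (ltW x_gt0)) lnXn ?sqrtr_gt0 //.
by rewrite -[ln _ *+ 2]mulr_natr mulfK // pnatr_eq0.
Qed.

Lemma pair_basis (a b : R) : (a, b) = a *: (1, 0) + b *: (0, 1) :> R * R.
Proof.
by congr pair; rewrite /= /GRing.scale /=; ring.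
Qed.

(** Both strain measures of [U = sqrt C] expressed by trace functions of [C],
    in terms of the logarithmic stretches [ln c / 2]. *)
Definition log_strains_of_gram C : R * R :=
  let t := \tr (mxfun (fun c => ln c / 2) C) in
  (\tr (mxfun (fun c => (ln c / 2) ^+ 2) C) - t ^+ 2 / 3, t ^+ 2).

Lemma log_strains_sqrtm C : sympos C ->
  log_strains (sqrtm C) = log_strains_of_gram C.
Proof.
move=> posC; have symC := sympos_sym posC.
have -> : log_strains (sqrtm C) = (frobnorm2 (dev3 (mxfun (fun c => ln c / 2) C)),
    `|\tr (mxfun (fun c => ln c / 2) C)| ^+ 2).
  rewrite /log_strains logm_mxfun sqrtm_mxfun //; last first.
    by apply: sympos_mxfun posC => x; rewrite sqrtr_gt0.
  rewrite mxfun_comp // (_ : mxfun _ C = mxfun (fun c => ln c / 2) C) //.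
  by apply: eq_mxfun_sympos => // x; apply: ln_sqrt.
rewrite /log_strains_of_gram.
have -> : mxfun (fun c => (ln c / 2) ^+ 2) C =
    mxfun (fun c => ln c / 2) C *m mxfun (fun c => ln c / 2) C.
  by rewrite mxfunM.
set Y := mxfun _ C.
have symY : Y^T = Y by exact: mxfun_sym.
rewrite real_normK ?num_real //; congr (_, _).
rewrite /frobnorm2 /dev3; set t := \tr Y.
rewrite [(Y - _)^T]linearB /= symY tr_scalar_mx mulmxBl !mulmxBr !mul_mx_scalar.
rewrite !mul_scalar_mx !raddfB /= !mxtraceZ mxtrace_scalar -/t.
by field.
Qed.

Lemma quadrant_log_strains (U : 'M[R]_3) : quadrant (log_strains U).
Proof.
split; last exact: sqr_ge0.
rewrite /= /frobnorm2 sumr_ge0 // => i _; rewrite mxE sumr_ge0 // => j _.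
by rewrite mxE -expr2 sqr_ge0.
Qed.

(** Both partial derivatives are read off one differential relative to the
    quadrant, so that they are available together in the chain rule. *)
Definition dstrain1 w (x : R * R) : R := 'd w (within quadrant (nbhs x)) (1, 0).
Definition dstrain2 w (x : R * R) : R := 'd w (within quadrant (nbhs x)) (0, 1).

(** A trace function [tr f(F^T F)] contributes [2 b f'(b)], evaluated at [b = B].
    For [f b = (ln b / 2) ^+ 2] this is [ln b], which is where the logarithm
    comes from; for [f b = ln b / 2] it is the constant 1. *)
Definition stress_of_left_gram w B : 'M[R]_3 :=
  let x := log_strains_of_gram B in
  let t := \tr (mxfun (fun b => ln b / 2) B) in
  (Num.sqrt (\det B))^-1 *:
    (dstrain1 w x *: mxfun (@ln R) B
     + (2 * t * (dstrain2 w x - dstrain1 w x / 3))%:M).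

Lemma is_diff_energy w F : quadrant_differentiable w -> GLpos F ->
  let C := F^T *m F in
  let x := log_strains_of_gram C in
  let t := \tr (mxfun (fun c => ln c / 2) C) in
  is_diff F (energy w) (frob_form
    (dstrain1 w x *: (2%:R *: (F *m mxfun (fun c => ln c / 2 / c) C))
     + (2 * t * (dstrain2 w x - dstrain1 w x / 3)) *:
         (2%:R *: (F *m mxfun (fun c => (2 * c)^-1) C)))).
Proof.
move=> w_diff F_pos C x t.
have F_unit := GLpos_unit F_pos.
have posC : sympos C by exact: sympos_gram.
have [Q [e QeC]] := sym_diagonalizes (sympos_sym posC).
have e_gt0 := sympos_eig_gt0 posC QeC.
set MN := 2%:R *: (F *m mxfun (fun c => ln c / 2 / c) C).
set MT := 2%:R *: (F *m mxfun (fun c => (2 * c)^-1) C).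
pose N (X : 'M[R]_3) : R := \tr (mxfun (fun c => (ln c / 2) ^+ 2) (X^T *m X)).
pose T (X : 'M[R]_3) : R := \tr (mxfun (fun c => ln c / 2) (X^T *m X)).
have diffN : is_diff F N (frob_form MN).
  exact: is_diff_trace_fun QeC e_gt0 (@sqr_half_ln_taylor R).
have diffT : is_diff F T (frob_form MT).
  exact: is_diff_trace_fun QeC e_gt0 (@half_ln_taylor R).
pose G (X : 'M[R]_3) := log_strains_of_gram (X^T *m X).
pose dG (E : 'M[R]_3) : R * R :=
  (frob_form MN E - 2 * t / 3 * frob_form MT E, 2 * t * frob_form MT E).
have diffG : is_diff F G dG.
  have diffT2 : is_diff F (T ^+ 2) (2 * t *: frob_form MT).
    by apply: is_diff_eq; rewrite expr1.
  have diffN' : is_diff F (N - 3^-1 *: T ^+ 2)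
      (frob_form MN - 3^-1 *: (2 * t *: frob_form MT) : 'M[R]_3 -> R).
    exact: is_diffB.
  have -> : G = (fun X => ((N - 3^-1 *: T ^+ 2) X, (T ^+ 2) X)).
    by apply/funext => X; rewrite /G /log_strains_of_gram -/(T X) -/(N X) !fctE mulrC.
  apply: is_diff_eq.
  apply/funext => E; rewrite /dG !fctE.
  by congr (_ - _, _); rewrite /GRing.scale /=; ring.
have near_sympos : \forall X \near F, sympos (X^T *m X).
  by apply: filterS (near_unitmx F_unit) => X; apply: sympos_gram.
have near_G : \forall X \near F, G X = log_strains (sqrtm (X^T *m X)).
  by apply: filterS near_sympos => X posX; rewrite log_strains_sqrtm.
have quadG : \forall X \near F, quadrant (G X).
  by apply: filterS near_G => X ->; apply: quadrant_log_strains.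
have wx : differentiable w (within quadrant (nbhs (G F))).
  by apply: w_diff; apply: (nbhs_singleton quadG).
have diffE := is_diff_comp_within diffG quadG wx.
apply: (@is_diff_near_eq R _ _ (w \o G)).
  by apply: filterS near_G => X; rewrite /energy /= => ->.
apply: is_diff_eq; apply/funext => E /=.
rewrite /dG pair_basis linearD !linearZ /= -/(dstrain1 w x) -/(dstrain2 w x).
rewrite frob_formD !frob_formZ /GRing.scale /=.
move: (dstrain1 w x) (dstrain2 w x) (frob_form MN E) (frob_form MT E).
by move=> w1 w2 dN dT; move: (t) => t0; ring.
Qed.

Lemma cauchy_stress_energy w F : quadrant_differentiable w -> GLpos F ->
  cauchy_stress (energy w) F = stress_of_left_gram w (F *m F^T).
Proof.
move=> w_diff F_pos; have /= dW := is_diff_energy w_diff F_pos.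
set B := F *m F^T; set C := F^T *m F in dW.
have F_unit := GLpos_unit F_pos.
have posB : sympos B.
  by have := @sympos_gram F^T; rewrite trmxK unitmx_tr; apply.
have symB := sympos_sym posB.
have symC : C^T = C by rewrite trmx_mul trmxK.
have BF f : mxfun f B *m F = F *m mxfun f C.
  by apply: mxfun_intertwine => //; rewrite mulmxA.
have tr_eq f : \tr (mxfun f C) = \tr (mxfun f B).
  by rewrite -[mxfun f C](mulKmx F_unit) -BF mxtrace_mulC mulmxK.
have strains_eq : log_strains_of_gram C = log_strains_of_gram B.
  by rewrite /log_strains_of_gram !tr_eq.
have det_eq : Num.sqrt (\det B) = \det F.
  by rewrite det_mulmx det_tr -expr2 sqrtr_sqr gtr0_norm.
rewrite strains_eq tr_eq in dW.
rewrite /cauchy_stress /stress_of_left_gram det_eq; congr (_ *: _).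
set M := (X in is_diff _ _ (frob_form X)) in dW.
have -> : mxgrad (energy w) F = M.
  by apply/matrixP => i j; rewrite mxE diff_val frob_form_delta.
have FgF g h : (forall b, 0 < b -> 2 * (g b * b) = h b) ->
    2%:R *: (F *m mxfun g C) *m F^T = mxfun h B.
  move=> gh; rewrite -BF -scalemxAl -mulmxA -/B -[X in _ *m X]mxfun_id //.
  by rewrite mxfunM // mxfunZ //; apply: eq_mxfun_sympos.
rewrite /M mulmxDl -scalemxAl (FgF _ (@ln R)); last first.
  by move=> b b_gt0; field; rewrite gt_eqF.
rewrite -scalemxAl (FgF _ (fun=> 1)); last by move=> b b_gt0; field; rewrite gt_eqF.
by rewrite mxfun_cst // scale_scalar_mx mulr1.
Qed.

End Stress.

(** * The weak empirical inequalities *)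

Section WeakEmpiricalInequalities.
Context {R : realType}.
Implicit Types (B P Q : 'M[R]_3) (d : 'rV[R]_3) (w : R * R -> R).

(** The limit is taken along a proper filter: the quadrant contains
    [(x.1 + h, x.2)] for every [h > 0]. *)
Lemma partial1_dstrain1 w (x : R * R) :
  quadrant_differentiable w -> quadrant x -> partial1 w x = dstrain1 w x.
Proof.
move=> w_diff qx.
have [_ w_exp] := differentiable_within_expansion qx (w_diff x qx).
set D := [set h : R | quadrant (x.1 + h, x.2)].
have FF : ProperFilter (within D 0^').
  apply: Build_ProperFilter_ex => P nearP.
  have : \forall h \near (0 : R), h != 0 -> D h -> P h by exact: nearP.
  move=> /nbhs_norm0P[e /= e_gt0 eP].
  have e2_gt0 : 0 < e / 2 by rewrite divr_gt0.
  exists (e / 2); apply: (eP (e / 2)) => /=.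
  - by rewrite gtr0_norm // ltr_pdivrMr // ltr_pMr // ltr1n.
  - exact: lt0r_neq0.
  - by case: qx => x1 x2; split => //=; rewrite addr_ge0 // ltW.
apply: cvg_lim => //.
apply/(@cvgrPdist_le R R^o) => eps eps_gt0.
have /nbhs_normP[e /= e_gt0 we] := w_exp _ eps_gt0.
suff : \forall h \near (0 : R), h != 0 -> D h ->
    `|dstrain1 w x - h^-1 * (w (x.1 + h, x.2) - w x)| <= eps by [].
apply/nbhs_norm0P; exists e => //= h he h_neq0 Dh.
have step : (x.1 + h, x.2) - x = h *: (1, 0) :> R * R.
  rewrite [x in LHS]surjective_pairing; congr pair; rewrite /= /GRing.scale /=; ring.
have norm_step : `|h *: (1, 0) : R * R| = `|h|.
  by rewrite normrZ prod_normE /= normr1 normr0 max_l ?mulr1 // ler01.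
have := we (x.1 + h, x.2); rewrite /= distrC step norm_step => /(_ he Dh).
rewrite linearZ /= -/(dstrain1 w x) => wh.
rewrite -(ler_pM2r (_ : 0 < `|h|)) ?normr_gt0 //; apply: le_trans wh.
by rewrite -normrM distrC mulrBl mulrAC mulVf // mul1r [_ * h]mulrC.
Qed.

Lemma prod_XsubC3 (a b c : R) :
  ('X - a%:P) * (('X - b%:P) * ('X - c%:P)) =
  'X ^+ 3 - (a + b + c)%:P * 'X ^+ 2 + (a * b + b * c + a * c)%:P * 'X
   - (a * b * c)%:P.
Proof. by rewrite !(polyCD, polyCM); ring. Qed.

Definition eig_seq d : seq R := [seq d 0 i | i : 'I_3].

Lemma big_eig_seq (S : Type) (idx : S) (op : Monoid.com_law idx) d (f : R -> S) :
  \big[op/idx]_(x <- eig_seq d) f x = \big[op/idx]_i f (d 0 i).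
Proof. by rewrite big_image. Qed.

(** The principal invariants are the coefficients of the characteristic
    polynomial, so they determine the eigenvalues up to order. *)
Lemma invariants_eig_perm P d B P' d' B' :
  diagonalizes P d B -> diagonalizes P' d' B' ->
  inv1 B = inv1 B' -> inv2 B = inv2 B' -> inv3 B = inv3 B' ->
  perm_eq (eig_seq d) (eig_seq d').
Proof.
have charE Q e A : diagonalizes Q e A ->
  \prod_(x <- eig_seq e) ('X - x%:P) =
  'X ^+ 3 - (inv1 A)%:P * 'X ^+ 2 + (inv2 A)%:P * 'X - (inv3 A)%:P.
  move=> QeA; have symA := diagonalizes_sym QeA.
  have tr2 : \tr (A *m A) = \sum_i e 0 i ^+ 2.
    rewrite -[X in X *m _](mxfun_id symA) -[X in _ *m X](mxfun_id symA) mxfunM //.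
    by rewrite (trace_mxfun _ QeA); apply: eq_bigr => i _; rewrite expr2.
  rewrite (@big_eig_seq _ _ *%R) /inv1 /inv2 /inv3 tr2 (trace_diagonalizes QeA).
  rewrite (det_diagonalizes QeA) !big_ord_recl !big_ord0 !mulr1 !addr0.
  rewrite /= mulr1 prod_XsubC3; congr (_ - _%:P * _ + _%:P * _ - _%:P).
  - by rewrite addrA.
  - by field.
  - by rewrite mulrA.
move=> /charE cB /charE cB' i1 i2 i3.
by apply: prod_XsubC_eq; rewrite cB cB' i1 i2 i3.
Qed.

Lemma sum_eig_perm d d' (f : R -> R) : perm_eq (eig_seq d) (eig_seq d') ->
  \sum_i f (d 0 i) = \sum_i f (d' 0 i).
Proof.
by move=> dd'; rewrite -!(@big_eig_seq _ _ +%R); apply: perm_big.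
Qed.

Lemma mem_eig_seq d i : d 0 i \in eig_seq d.
Proof. by apply: map_f; rewrite mem_enum. Qed.

Lemma sympos_det_gt0 B : sympos B -> 0 < \det B.
Proof.
move=> posB; have [P [d PdB]] := sym_diagonalizes (sympos_sym posB).
rewrite (det_diagonalizes PdB) prodr_gt0 // => i _.
exact: sympos_eig_gt0 posB PdB i.
Qed.

Lemma invmx_mxfun B : sympos B -> invmx B = mxfun GRing.inv B.
Proof.
move=> posB; have symB := sympos_sym posB.
have B_unit : B \in unitmx.
  by rewrite unitmxE unitfE gt_eqF // sympos_det_gt0.
apply: (can_inj (mulKmx B_unit)); rewrite mulmxV // -[X in X *m _]mxfun_id //.
rewrite mxfunM // -(mxfun_cst 1 symB); apply: eq_mxfun_sympos => // x x_gt0.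
by rewrite divff // gt_eqF.
Qed.

Lemma isotropic_stress_of_left_gram w : isotropic (@stress_of_left_gram R w).
Proof.
split=> [B posB|B Q posB QQ].
  have symB := sympos_sym posB; apply/symmetricmxP.
  by rewrite linearZ linearD linearZ /= mxfun_sym // tr_scalar_mx.
have symB := sympos_sym posB; have QQ' := mulmx1C QQ.
have tr_eq f : \tr (mxfun f (Q^T *m B *m Q)) = \tr (mxfun f B).
  by rewrite mxfun_conj // mxtrace_mulC mulmxA QQ' mul1mx.
have det_eq : \det (Q^T *m B *m Q) = \det B.
  by rewrite !det_mulmx mulrAC -det_mulmx QQ det1 mul1r.
rewrite /stress_of_left_gram /log_strains_of_gram !tr_eq det_eq mxfun_conj //.
rewrite -scalemxAr -scalemxAl mulmxDr mulmxDl -scalemxAr -scalemxAl.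
by rewrite mul_mx_scalar -scalemxAl QQ scalemx1.
Qed.

(** One interpolation of the logarithm at the eigenvalues of [B] serves every
    matrix that has the same invariants. *)
Lemma WE_coefficients w B0 :
  (forall U : 'M[R]_3, sympos U -> 0 < dstrain1 w (log_strains U)) ->
  sympos B0 ->
  exists b : R * R * R, forall B, sympos B ->
    inv1 B = inv1 B0 -> inv2 B = inv2 B0 -> inv3 B = inv3 B0 ->
    stress_of_left_gram w B = b.1.1%:M + b.1.2 *: B + b.2 *: invmx B /\
    (~ (exists a : R, 0 < a /\ B = a%:M) ->
     [/\ b.2 <= 0, 0 <= b.1.2 & b.2 < 0 \/ 0 < b.1.2]).
Proof.
move=> w_pos posB0; have [P0 [d0 PdB0]] := sym_diagonalizes (sympos_sym posB0).
have d0_gt0 := sympos_eig_gt0 posB0 PdB0.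
pose x := log_strains_of_gram B0.
pose t := \tr (mxfun (fun b => ln b / 2) B0).
pose J := (Num.sqrt (\det B0))^-1.
have J_gt0 : 0 < J by rewrite invr_gt0 sqrtr_gt0 sympos_det_gt0.
have w1_gt0 : 0 < dstrain1 w x.
  rewrite /x -log_strains_sqrtm //; apply: w_pos; rewrite sqrtm_mxfun //.
  by apply: sympos_mxfun posB0 => y; rewrite sqrtr_gt0.
have Jw1_gt0 : 0 < J * dstrain1 w x by rewrite mulr_gt0.
(* It suffices to interpolate [ln] at the eigenvalues of [B0]. *)
have reduce a0 a1 c : (forall i, ln (d0 0 i) = a0 + a1 * d0 0 i + c / d0 0 i) ->
    forall B, sympos B ->
    inv1 B = inv1 B0 -> inv2 B = inv2 B0 -> inv3 B = inv3 B0 ->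
    stress_of_left_gram w B =
      (J * (dstrain1 w x * a0 + 2 * t * (dstrain2 w x - dstrain1 w x / 3)))%:M
      + (J * dstrain1 w x * a1) *: B + (J * dstrain1 w x * c) *: invmx B.
  move=> ln_d0 B posB i1 i2 i3; have symB := sympos_sym posB.
  have [P [d PdB]] := sym_diagonalizes symB.
  have dd0 := invariants_eig_perm PdB PdB0 i1 i2 i3.
  have tr_eq f : \tr (mxfun f B) = \tr (mxfun f B0).
    by rewrite (trace_mxfun _ PdB) (trace_mxfun _ PdB0); apply: sum_eig_perm.
  have lnB : mxfun (@ln R) B = a0%:M + a1 *: B + c *: invmx B.
    rewrite invmx_mxfun // -[X in a1 *: X]mxfun_id // -(mxfun_cst a0 symB).
    rewrite !mxfunZ // !mxfunD //; apply: (eq_mxfun PdB) => i.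
    have : d 0 i \in eig_seq d0 by rewrite -(perm_mem dd0) mem_eig_seq.
    by case/mapP => j _ ->; apply: ln_d0.
  have x_eq : log_strains_of_gram B = x.
    by rewrite /x /log_strains_of_gram !tr_eq.
  rewrite /stress_of_left_gram x_eq tr_eq -/t.
  rewrite -/(inv3 B) i3 -/J lnB !scalerDr !scale_scalar_mx !scalerA.
  rewrite [J * (_ + _)]mulrDr [(_ + _)%:M in RHS]raddfD /= !mulrA -!addrA.
  by congr (_ + _); rewrite [LHS]addrA addrC.
(* If all eigenvalues agree, a constant interpolates and [B] is scalar. *)
have [d0_eq|d0_neq] := pselect (d0 0 0 = d0 0 1 /\ d0 0 1 = d0 0 2).
  have d0E i : d0 0 i = d0 0 0.
    case: d0_eq => e01 e12; case: i => -[|[|[|//]]] lt_i.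
    - by congr (d0 0 _); apply: val_inj.
    - by rewrite e01; congr (d0 0 _); apply: val_inj.
    - by rewrite e01 e12; congr (d0 0 _); apply: val_inj.
  have ln_d0 i : ln (d0 0 i) = ln (d0 0 0) + 0 * d0 0 i + 0 / d0 0 i.
    by rewrite !mul0r !addr0 d0E.
  eexists (_, _, _) => B posB i1 i2 i3; split; first exact: reduce ln_d0 _ _ _ _ _.
  case; exists (d0 0 0); split => //.
  have symB := sympos_sym posB; have [P [d PdB]] := sym_diagonalizes symB.
  have dd0 := invariants_eig_perm PdB PdB0 i1 i2 i3.
  rewrite -(mxfun_cst _ symB) -[LHS]mxfun_id //; apply: (eq_mxfun PdB) => i.
  have : d 0 i \in eig_seq d0 by rewrite -(perm_mem dd0) mem_eig_seq.
  by case/mapP => j _ ->.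
have [a0 [a1 [c [c_le0 a1_ge0 strict [ln0 ln1 ln2]]]]] :=
  ln_interpolation (d0_gt0 0) (d0_gt0 1) (d0_gt0 2) d0_neq.
have ln_d0 i : ln (d0 0 i) = a0 + a1 * d0 0 i + c / d0 0 i.
  case: i => -[|[|[|//]]] lt_i.
  - by rewrite (_ : Ordinal lt_i = 0) //; apply: val_inj.
  - by rewrite (_ : Ordinal lt_i = 1) //; apply: val_inj.
  - by rewrite (_ : Ordinal lt_i = 2) //; apply: val_inj.
eexists (_, _, _) => B posB i1 i2 i3; split; first exact: reduce ln_d0 _ _ _ _ _.
move=> _ /=; rewrite pmulr_rle0 // pmulr_rge0 // pmulr_rlt0 // pmulr_rgt0 //.
Qed.

Lemma WE_TSS_stress_of_left_gram w :
  (forall U : 'M[R]_3, sympos U -> 0 < dstrain1 w (log_strains U)) ->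
  WE_TSS (@stress_of_left_gram R w).
Proof.
move=> w_pos.
(* Coefficients are chosen for each triple of invariants that occurs. *)
pose coef (i : R * R * R) (b : R * R * R) := forall B, sympos B ->
    inv1 B = i.1.1 -> inv2 B = i.1.2 -> inv3 B = i.2 ->
    stress_of_left_gram w B = b.1.1%:M + b.1.2 *: B + b.2 *: invmx B /\
    (~ (exists a : R, 0 < a /\ B = a%:M) ->
     [/\ b.2 <= 0, 0 <= b.1.2 & b.2 < 0 \/ 0 < b.1.2]).
have /choice [b bP] : forall i, exists b, coef i b.
  move=> [[i1 i2] i3].
  have [[B0 [posB0 j1 j2 j3]]|noB] := pselect (exists B0 : 'M[R]_3,
    [/\ sympos B0, inv1 B0 = i1, inv2 B0 = i2 & inv3 B0 = i3]).
    have [b bP] := WE_coefficients w_pos posB0.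
    by exists b => B posB /=; rewrite -j1 -j2 -j3; apply: bP.
  exists (0, 0, 0) => B posB /= j1 j2 j3.
  by case: noB; exists B.
exists (fun i1 i2 i3 => (b (i1, i2, i3)).1.1),
  (fun i1 i2 i3 => (b (i1, i2, i3)).1.2), (fun i1 i2 i3 => (b (i1, i2, i3)).2).
split=> B posB; first by case: (bP (inv1 B, inv2 B, inv3 B) B posB erefl erefl erefl).
by case: (bP (inv1 B, inv2 B, inv3 B) B posB erefl erefl erefl).
Qed.

End WeakEmpiricalInequalities.

Unset Implicit Arguments.

Theorem theorem4p6 (R : realType) (w : R * R -> R)
    (w_diff : quadrant_differentiable w)
    (w_pos : forall U : 'M[R]_3, sympos U -> 0 < partial1 w (log_strains U)) :
  exists s : 'M[R]_3 -> 'M[R]_3,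
    cauchy_response (energy w) s /\ WE_TSS s.
Proof.
exists (stress_of_left_gram w); split; last first.
  apply: WE_TSS_stress_of_left_gram => U /w_pos.
  by rewrite partial1_dstrain1 //; apply: quadrant_log_strains.
split.
- by move=> F F_pos; have /= [] := is_diff_energy w_diff F_pos.
- exact: isotropic_stress_of_left_gram.
- by move=> F F_pos; rewrite cauchy_stress_energy.
Qed.
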